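(* Let $N$ be a Cartan semigroup in a C*-algebra $A$, and let $B=C^*(N_+)$. Then the expectation $E$ from $A$ onto $B$ satisfying $E(n)n^*\in B$ for all $n\in N$ is unique.
   Context: For a subset $N$ of a C*-algebra $A$, $N_+:=\{n^*n:n\in N\}$ and $C^*(N)$ is the C*-subalgebra generated by $N$. An expectation is a contractive idempotent linear map $A\to A$. $N\subseteq A$ is a Cartan semigroup if: (1) $N$ is a norm-closed *-subsemigroup of $A$ (closed under products and adjoints) with dense linear span in $A$; (2) $B:=C^*(N_+)$ is commutative and contained in $N$; (3) there is an expectation $E$ from $A$ onto $B$ with $E(n)n^*\in B$ for all $n\in N$. *)

(* Defs.v *)
From HB Require Import structures.
From mathcomp Require Import all_boot all_order all_algebra.
From mathcomp Require Import complex.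
From mathcomp Require Import all_classical all_reals all_analysis.

Set Implicit Arguments.
Unset Strict Implicit.
Unset Printing Implicit Defensive.

Import Order.TTheory GRing.Theory Num.Theory.
Import numFieldNormedType.Exports.
Local Open Scope classical_set_scope.
Local Open Scope complex_scope.
Local Open Scope ring_scope.

(* C*-algebras are not assumed to be unital, so the product cannot come from
   the library's ring structures.  Norms take their values in R[i], where
   0 <= z means that z is a nonnegative real. *)
HB.mixin Record CompleteNormedModule_isCStarAlgebra (R : realType) A
    & CompleteNormedModule R[i] A := {
  cmul : A -> A -> A;
  star : A -> A;
  cmulA : forall x y z, cmul x (cmul y z) = cmul (cmul x y) z;
  cmulPl : forall (a : R[i]) (x y z : A),
    cmul (a *: x + y) z = a *: cmul x z + cmul y z;
  cmulPr : forall (a : R[i]) (x y z : A),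
    cmul z (a *: x + y) = a *: cmul z x + cmul z y;
  star_semilinear : forall (a : R[i]) (x y : A),
    star (a *: x + y) = conjc a *: star x + star y;
  starK : forall x : A, star (star x) = x;
  starM : forall x y : A, star (cmul x y) = cmul (star y) (star x);
  ler_normM : forall x y : A, `|cmul x y| <= `|x| * `|y|;
  norm_starM : forall x : A, `|cmul (star x) x| = `|x| ^+ 2
}.

#[short(type="cstarAlgType")]
HB.structure Definition CStarAlgebra (R : realType) :=
  {A of CompleteNormedModule R[i] A
   & CompleteNormedModule_isCStarAlgebra R A}.

Notation "x ** y" := (cmul x y) (at level 40, left associativity) : ring_scope.

Definition linear_span (K : numFieldType) (V : lmodType K) (S : set V) : set V :=
  [set x | exists (n : nat) (a : 'I_n -> K) (v : 'I_n -> V),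
     (forall i, S (v i)) /\ x = \sum_(i < n) a i *: v i].

Section CartanSemigroup.
Variables (R : realType) (A : cstarAlgType R).
Implicit Types (N S B : set A) (E : A -> A).

Definition star_subsemigroup S : Prop :=
  (forall x y : A, S x -> S y -> S (x ** y)) /\
  (forall x : A, S x -> S (star x)).

Definition cstar_subalgebra S : Prop :=
  [/\ S 0,
      forall (a : R[i]) (x y : A), S x -> S y -> S (a *: x + y),
      star_subsemigroup S
    & closed S].

Definition cstar_generated S : set A := smallest cstar_subalgebra S.

Definition positive_part N : set A := [set star n ** n | n in N].

Definition is_expectation E : Prop :=
  [/\ linear E,
      forall x : A, `|E x| <= `|x|
    & forall x : A, E (E x) = E x].

Definition expectation_onto B E : Prop := is_expectation E /\ range E = B.

Definition cartan_base N : set A := cstar_generated (positive_part N).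

Definition cartan_expectation N E : Prop :=
  expectation_onto (cartan_base N) E /\
  (forall n : A, N n -> cartan_base N (E n ** star n)).

Definition cartan_semigroup N : Prop :=
  [/\ [/\ closed N, star_subsemigroup N & dense (linear_span N : set A)],
      (forall x y : A, cartan_base N x -> cartan_base N y -> x ** y = y ** x) /\
        cartan_base N `<=` N
    & exists E : A -> A, cartan_expectation N E].

End CartanSemigroup.

(* Main.v *)
Require Import Defs.
From HB Require Import structures.
From mathcomp Require Import all_boot all_order all_algebra.
From mathcomp Require Import complex.
From mathcomp Require Import all_classical all_reals all_analysis.
From mathcomp Require Import lra.

(** Let e := E n and f := F n for two such expectations and n in N.  If E were a
    B-module map, E (n f^* ) = e f^*, whereas n f^* = (f n^* )^* lies in B and is
    fixed by both expectations; thus e f^* = n f^* = f f^*, symmetrically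
    f e^* = e e^*, and (e - f) (e - f)^* = 0.  So E and F agree on N, hence on
    its dense span by linearity and contractivity.

    It remains to show E n b = n b when b and n b lie in B ([expectation_cmul]),
    an instance of Tomiyama's theorem on contractive projections.  The usual
    proof takes place in the bidual, where there are enough projections; here
    projections are replaced by a contractive approximate unit.  Regard A as a
    Hilbert module over itself.  For symmetric operators the identity
    norm (x + i T x) = norm (x - i T x) yields that 1 - T ^+ 2 is a contraction
    whenever T is one ([rnorm_sub_sqr]).  With T right multiplication by a small
    multiple of b b^* and V := (1 - T ^+ 2) ^+ 2, the ergodic averages avg m of V
    are symmetric contractions, the operators f m := 1 - avg m are contractions
    too, avg m (f k x) tends to 0, and f m n lies in B.

    Let v := E n - n.  Then E maps avg m n + t (f l v) to
    v + avg m n + t (f l v).  The two summands of the argument become orthogonal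
    as m grows, so its norm squared is asymptotically at most
    norm n ^+ 2 + t ^+ 2 * norm (f l v) ^+ 2, while applying the contraction
    f k to the image gives in the limit, as l grows too, (1 + t) (f k v).  With
    L the supremum of the norms of the f k v this says
    (1 + t) ^+ 2 * L ^+ 2 <= norm n ^+ 2 + t ^+ 2 * L ^+ 2 for all t >= 0,
    hence L = 0, v = V v and finally v b = 0. *)

Set Implicit Arguments.
Unset Strict Implicit.
Unset Printing Implicit Defensive.

Import Order.TTheory GRing.Theory Num.Theory.
Import numFieldNormedType.Exports.
Local Open Scope classical_set_scope.
Local Open Scope complex_scope.
Local Open Scope ring_scope.

(** * A real sequence that improves its own bounds *)

(** The supremum L of the a k inherits (1 + t) ^+ 2 * L ^+ 2 <= c + (t * L) ^+ 2,
    that is (1 + 2 * t) * L ^+ 2 <= c; letting t grow gives L = 0. *)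
Lemma bounded_self_improving (R : realType) (a : nat -> R) (c M : R) : 0 <= c ->
    (forall k, 0 <= a k <= M) ->
    (forall t L : R, 0 <= t -> (forall k, a k <= L) -> forall k,
      (1 + t) * a k <= Num.sqrt (c + (t * L) ^+ 2)) ->
  forall k, a k = 0.
Proof.
move=> c0 aM improve k; have a0 j : 0 <= a j by case/andP: (aM j).
pose L := sup (range a).
have aL j : a j <= L.
  by apply: ub_le_sup; [exists M => _ [i _ <-]; case/andP: (aM i)|exists j].
have L0 : 0 <= L by apply: le_trans (aL 0%N).
have bound (t : R) : 0 <= t -> (1 + 2 * t) * L ^+ 2 <= c.
  move=> t0; have t1 : 0 < 1 + t by rewrite ltr_pwDl.
  have : (1 + t) * L <= Num.sqrt (c + (t * L) ^+ 2).
    rewrite mulrC -ler_pdivlMr//; apply: ge_sup; first by exists (a 0%N), 0%N.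
    by move=> _ [j _ <-]; rewrite ler_pdivlMr// mulrC improve.
  rewrite -(@ler_pXn2r _ 2)// ?nnegrE ?sqrtr_ge0 ?mulr_ge0 ?(ltW t1)//.
  rewrite sqr_sqrtr ?addr_ge0 ?sqr_ge0//; nra.
have L20 : L ^+ 2 = 0.
  (* at t = c / L ^+ 2 the bound reads L ^+ 2 + 2 * c <= c, against 0 < L ^+ 2 *)
  apply/eqP/negPn/negP => LN0.
  have L2gt0 : 0 < L ^+ 2 by rewrite lt_neqAle eq_sym LN0 sqr_ge0.
  have := bound (c / L ^+ 2) (divr_ge0 c0 (ltW L2gt0)).
  rewrite mulrDl mul1r -mulrA divfK//; lra.
apply/le_anti; rewrite a0 andbT; apply: le_trans (aL k) _.
by move/eqP: L20; rewrite sqrf_eq0 => /eqP ->.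
Qed.

(** * Arithmetic of non-unital C*-algebras *)

Section CStarAlgebraTheory.
Variables (R : realType) (A : cstarAlgType R).
Implicit Types (a b d x y z : A) (S : set A).

Lemma cmulDl x y z : (x + y) ** z = x ** z + y ** z.
Proof. by have := cmulPl 1 x y z; rewrite !scale1r. Qed.

Lemma cmulDr x y z : z ** (x + y) = z ** x + z ** y.
Proof. by have := cmulPr 1 x y z; rewrite !scale1r. Qed.

Lemma cmul0l z : 0 ** z = 0 :> A.
Proof. by apply: (addrI (0 ** z)); rewrite -cmulDl !addr0. Qed.

Lemma cmul0r z : z ** 0 = 0 :> A.
Proof. by apply: (addrI (z ** 0)); rewrite -cmulDr !addr0. Qed.

Lemma cmulZl (k : R[i]) x z : (k *: x) ** z = k *: (x ** z).
Proof. by rewrite -[k *: x]addr0 cmulPl cmul0l addr0. Qed.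

Lemma cmulZr (k : R[i]) x z : z ** (k *: x) = k *: (z ** x).
Proof. by rewrite -[k *: x]addr0 cmulPr cmul0r addr0. Qed.

Lemma cmulNl x z : (- x) ** z = - (x ** z).
Proof. by rewrite -scaleN1r cmulZl scaleN1r. Qed.

Lemma cmulNr x z : z ** (- x) = - (z ** x).
Proof. by rewrite -scaleN1r cmulZr scaleN1r. Qed.

Lemma cmulBl x y z : (x - y) ** z = x ** z - y ** z.
Proof. by rewrite cmulDl cmulNl. Qed.

Lemma cmulBr x y z : z ** (x - y) = z ** x - z ** y.
Proof. by rewrite cmulDr cmulNr. Qed.

Lemma starD x y : star (x + y) = star x + star y :> A.
Proof. by have := star_semilinear 1 x y; rewrite conjc1 !scale1r. Qed.

Lemma star0 : star 0 = 0 :> A.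
Proof. by apply: (addrI (star 0)); rewrite -starD !addr0. Qed.

Lemma starZ (k : R[i]) x : star (k *: x) = conjc k *: star x.
Proof. by rewrite -[k *: x]addr0 star_semilinear star0 addr0. Qed.

Lemma starN x : star (- x) = - star x :> A.
Proof. by apply: (addrI (star x)); rewrite -starD !subrr star0. Qed.

Lemma starB x y : star (x - y) = star x - star y :> A.
Proof. by rewrite starD starN. Qed.

(** The norm of A takes its values in R[i], whose order is partial; its real part
    makes ordered-field reasoning available. *)
Definition rnorm x : R := complex.Re `|x|.

Lemma rnormE x : (rnorm x)%:C = `|x|.
Proof. by rewrite /rnorm RRe_real// normr_real. Qed.

Lemma rnorm_ge0 x : 0 <= rnorm x.
Proof. by rewrite -ler0c rnormE. Qed.

Lemma rnorm_le x y : (rnorm x <= rnorm y) = (`|x| <= `|y|).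
Proof. by rewrite -lecR !rnormE. Qed.

Lemma rnorm0 : rnorm 0 = 0.
Proof. by rewrite /rnorm normr0. Qed.

Lemma rnorm0_eq0 x : rnorm x = 0 -> x = 0.
Proof. by move=> x0; apply/normr0_eq0; rewrite -rnormE x0. Qed.

Lemma rnormN x : rnorm (- x) = rnorm x.
Proof. by rewrite /rnorm normrN. Qed.

Lemma rnormD x y : rnorm (x + y) <= rnorm x + rnorm y.
Proof. by rewrite -lecR rmorphD/= !rnormE ler_normD. Qed.

Lemma rnormB x y : rnorm (x - y) <= rnorm x + rnorm y.
Proof. by rewrite -(rnormN y) rnormD. Qed.

Lemma rnorm_sum (I : Type) (r : seq I) (P : pred I) (F : I -> A) :
  rnorm (\sum_(i <- r | P i) F i) <= \sum_(i <- r | P i) rnorm (F i).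
Proof.
elim/big_ind2 : _ => //; first by rewrite rnorm0.
by move=> x1 r1 x2 r2 h1 h2; apply: le_trans (rnormD _ _) (lerD h1 h2).
Qed.

Lemma rnormZ (r : R) x : 0 <= r -> rnorm (r%:C *: x) = r * rnorm x.
Proof.
move=> r0; apply: complexI; rewrite rmorphM/= !rnormE normrZ ger0_norm//.
by rewrite ler0c.
Qed.

Lemma rnormM x y : rnorm (x ** y) <= rnorm x * rnorm y.
Proof. by rewrite -lecR rmorphM/= !rnormE ler_normM. Qed.

Lemma rnorm_starM x : rnorm (star x ** x) = rnorm x ^+ 2.
Proof. by apply: complexI; rewrite rmorphXn/= !rnormE norm_starM. Qed.

(** The C*-identity and submultiplicativity give norm x <= norm (star x). *)
Lemma rnorm_star x : rnorm (star x) = rnorm x.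
Proof.
have le_star z : rnorm z <= rnorm (star z).
  have [->|z0] := eqVneq (rnorm z) 0; first exact: rnorm_ge0.
  have zgt0 : 0 < rnorm z by rewrite lt_neqAle eq_sym z0 rnorm_ge0.
  by rewrite -(ler_pM2r zgt0) -expr2 -rnorm_starM rnormM.
by apply/le_anti; rewrite le_star andbT -{2}(starK x) le_star.
Qed.

Lemma rnormM_star x : rnorm (x ** star x) = rnorm x ^+ 2.
Proof. by rewrite -{1}(starK x) rnorm_starM rnorm_star. Qed.

Lemma cmul_star_eq0 x : x ** star x = 0 -> x = 0.
Proof.
move=> xx0; apply: rnorm0_eq0.
by apply/eqP; rewrite -sqrf_eq0 -rnormM_star xx0 rnorm0.
Qed.

Section LinearlyClosed.
Variable S : set A.
Hypothesis S0 : S 0.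
Hypothesis SP : forall (k : R[i]) x y, S x -> S y -> S (k *: x + y).

Lemma lin_closedZ (k : R[i]) x : S x -> S (k *: x).
Proof. by move=> Sx; rewrite -[k *: x]addr0; apply: SP. Qed.

Lemma lin_closedD x y : S x -> S y -> S (x + y).
Proof. by move=> Sx Sy; rewrite -[x]scale1r; apply: SP. Qed.

Lemma lin_closedB x y : S x -> S y -> S (x - y).
Proof.
by move=> Sx Sy; apply: lin_closedD => //; rewrite -scaleN1r; apply: lin_closedZ.
Qed.

End LinearlyClosed.

(** * Symmetric operators *)

(** A is a Hilbert module over itself for the A-valued inner product
    [x ** star y], and this is symmetry for that product.  The formalism lets
    the identity of A stand in for the missing unit of the algebra: 1 - d ^+ 2
    acts on A by right multiplication even though it is not an element of A. *)
Definition symmetric_op (T : A -> A) : Prop :=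
  forall x y, T x ** star y = x ** star (T y).

(** x + i T x and x - i T x have the same square, <x, x> + <T x, T x>, hence the
    same norm, and x is their mean. *)
Lemma rnorm_le_addZi (T : {linear A -> A}) x : symmetric_op T ->
  rnorm x <= rnorm (x + 'i%C *: T x).
Proof.
move=> symT.
have iJ : conjc 'i%C = - 'i%C :> R[i].
  by apply/eqP; rewrite eq_complex/= oppr0 !eqxx.
have i2 : 'i%C * 'i%C = -1 :> R[i] by rewrite -expr2 sqr_i.
have sq (k : R[i]) : conjc k = - k -> k * k = - 1 ->
    (x + k *: T x) ** star (x + k *: T x) = x ** star x + T x ** star (T x).
  move=> kJ k2; rewrite starD starZ kJ !(cmulDl, cmulDr) !cmulZl !cmulZr symT.
  rewrite scalerA mulrN k2 opprK scale1r scaleNr.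
  by rewrite addrA subrK.
have eq_norm : rnorm (x + 'i%C *: T x) = rnorm (x + (- 'i%C) *: T x).
  apply/eqP; rewrite -(@eqrXn2 _ 2)// ?rnorm_ge0// -!rnormM_star.
  rewrite (sq _ iJ i2) sq//.
  - by apply/eqP; rewrite eq_complex/= !oppr0 !eqxx.
  - by rewrite mulrNN.
have := rnormD (x + 'i%C *: T x) (x + (- 'i%C) *: T x).
rewrite -eq_norm addrACA scaleNr subrr addr0.
have -> : x + x = (2%:R)%:C *: x.
  by rewrite rmorphMn/= -scalerMnl scale1r mulr2n.
rewrite rnormZ ?ler0n//; lra.
Qed.

(** 1 + T ^+ 2 = (1 - i T) (1 + i T), and neither factor decreases norms. *)
Lemma rnorm_le_add_sqr (T : {linear A -> A}) x : symmetric_op T ->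
  rnorm x <= rnorm (x + T (T x)).
Proof.
move=> symT; apply: le_trans (rnorm_le_addZi x symT) _.
have symNT : symmetric_op (\- T).
  by move=> y z /=; rewrite cmulNl starN cmulNr symT.
apply: le_trans (@rnorm_le_addZi (\- T) _ symNT) _ => /=.
rewrite linearD linearZ/= scalerN scalerDr scalerA -expr2 sqr_i scaleN1r.
by rewrite opprD opprK addrA addrK.
Qed.

(** (1 + T ^+ 2) (1 - T ^+ 2) = 1 - T ^+ 4 bounds 1 - T ^+ 2 by the same
    expression in T ^+ 2, whose norm is at most r ^+ 2. *)
Lemma rnorm_sub_sqr_approx k (T : {linear A -> A}) (r : R) :
    symmetric_op T -> 0 <= r <= 1 -> (forall x, rnorm (T x) <= r * rnorm x) ->
  forall x, rnorm (x - T (T x)) <= (1 + r ^+ k.+1) * rnorm x.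
Proof.
elim: k T r => [|k IHk] T r symT /andP[r0 r1] Tr x.
  apply: le_trans (rnormB _ _) _; rewrite mulrDl mul1r lerD2l expr1.
  apply: le_trans (Tr _) _; apply: ler_wpM2l => //.
  by apply: le_trans (Tr _) _; rewrite ler_piMl ?rnorm_ge0.
apply: le_trans (rnorm_le_add_sqr _ symT) _.
rewrite !linearB/= addrA subrK.
have symTT : symmetric_op (T \o T) by move=> y z /=; rewrite !symT.
have r2 : 0 <= r ^+ 2 <= 1 by rewrite exprn_ge0// exprn_ile1.
have TTr y : rnorm ((T \o T) y) <= r ^+ 2 * rnorm y.
  rewrite expr2 -mulrA; apply: le_trans (Tr _) _.
  by apply: ler_wpM2l => //; exact: Tr.
apply: le_trans (IHk _ _ symTT r2 TTr x) _.
rewrite ler_wpM2r ?rnorm_ge0// lerD2l -exprM; apply: ler_wiXn2l => //.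
by rewrite mulnS add2n !ltnS mul2n -addnn leq_addr.
Qed.

(** The order relation 0 <= 1 - T ^+ 2 <= 1 in terms of norms, obtained without
    spectral theory: for r < 1 the operator r T satisfies the bound by the previous
    estimate with k tending to infinity, and then r tends to 1. *)
Lemma rnorm_sub_sqr (T : {linear A -> A}) : symmetric_op T ->
  (forall x, rnorm (T x) <= rnorm x) ->
  forall x, rnorm (x - T (T x)) <= rnorm x.
Proof.
move=> symT T1 x.
have scaled (r : R) : 0 <= r < 1 ->
    rnorm (x - (r ^+ 2)%:C *: T (T x)) <= rnorm x.
  move=> /andP[r0 r1].
  have symrT : symmetric_op (r%:C \*: T).
    by move=> y z /=; rewrite cmulZl starZ cmulZr symT conjc_real.
  have rTr y : rnorm ((r%:C \*: T) y) <= r * rnorm y.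
    by rewrite /= rnormZ// ler_wpM2l.
  have r01 : 0 <= r <= 1 by rewrite r0 ltW.
  have approx k :
      rnorm (x - (r ^+ 2)%:C *: T (T x)) <= (1 + r ^+ k.+1) * rnorm x.
    have := @rnorm_sub_sqr_approx k _ _ symrT r01 rTr x.
    by rewrite /= linearZ_LR scalerA -rmorphM -expr2.
  apply: (cvgr_to_ge (F := \oo) (f := fun k => (1 + r ^+ k.+1) * rnorm x)).
    rewrite -[X in _ --> X]mul1r; apply: cvgMl.
    rewrite -[X in _ --> X]addr0; apply: cvgD; first exact: cvg_cst.
    by rewrite (cvg_shiftS (GRing.exp r)); apply: cvg_expr; rewrite ger0_norm.
  by near=> k; exact: approx.
pose r k : R := 1 - k.+1%:R^-1.
apply: (cvgr_to_ge (F := \oo)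
  (f := fun k => rnorm x + (1 - r k * r k) * rnorm (T (T x)))).
  rewrite -[X in _ --> X]addr0; apply: cvgD; first exact: cvg_cst.
  rewrite -[X in _ --> X](mul0r (rnorm (T (T x)))); apply: cvgMl.
  have r1 : r @ \oo --> (1 : R).
    rewrite -[X in _ --> X]subr0; apply: cvgB; first exact: cvg_cst.
    exact: cvg_harmonic.
  rewrite -[X in _ --> X](subrr (1 : R)) -[X in _ - X]mulr1.
  by apply: cvgB; [exact: cvg_cst|exact: cvgM].
near=> k.
have r01 : 0 <= r k < 1.
  by rewrite subr_ge0 ltrBlDr ltrDl invr_gt0 ltr0n invf_le1 ?ltr0n// ler1n.
have -> : x - T (T x) =
    (x - (r k ^+ 2)%:C *: T (T x)) - (1 - r k * r k)%:C *: T (T x).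
  by rewrite rmorphB/= scalerBl scale1r expr2 opprB addrA subrK.
apply: le_trans (rnormB _ _) (lerD (scaled _ r01) _).
by rewrite rnormZ// subr_ge0 mulr_ile1//; case/andP: r01 => // _ /ltW.
Unshelve. all: by end_near. Qed.

(** * Ergodic averages *)

Section ErgodicAverages.
Variable V : {linear A -> A}.

Lemma iter_is_linear j : linear (iter j V).
Proof. by elim: j => [|j IHj] k x y//=; rewrite IHj linearP. Qed.

HB.instance Definition _ j :=
  GRing.isLinear.Build R[i] A A _ (iter j V) (iter_is_linear j).

Definition avg m x : A := (m.+1%:R^-1)%:C *: \sum_(j < m.+1) iter j V x.

Lemma avg_is_linear m : linear (avg m).
Proof.
move=> k x y; rewrite /avg scalerA mulrC -scalerA -scalerDr; congr (_ *: _).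
by rewrite scaler_sumr -big_split/=; apply: eq_bigr => j _; rewrite linearP.
Qed.

HB.instance Definition _ m :=
  GRing.isLinear.Build R[i] A A _ (avg m) (avg_is_linear m).

Lemma avg_comp m (T : {linear A -> A}) x : (forall y, T (V y) = V (T y)) ->
  T (avg m x) = avg m (T x).
Proof.
move=> TV; rewrite /avg linearZ_LR linear_sum; congr (_ *: _).
by apply: eq_bigr => j _; elim: (j : nat) => //= i <-.
Qed.

Lemma sub_avgE m x :
  x - avg m x = (m.+1%:R^-1)%:C *: \sum_(j < m.+1) (x - iter j V x).
Proof.
rewrite sumrB scalerBr sumr_const card_ord -[x *+ _]scaler_nat scalerA.
rewrite -(rmorph_nat (real_complex R)) -rmorphM mulVf ?pnatr_eq0//.
by rewrite rmorph1 scale1r.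
Qed.

Lemma rnorm_mean (F : nat -> A) m (c : R) : (forall j, rnorm (F j) <= c) ->
  rnorm ((m.+1%:R^-1)%:C *: \sum_(j < m.+1) F j) <= c.
Proof.
move=> Fc; rewrite rnormZ ?invr_ge0// ler_pdivrMl ?ltr0n//.
apply: le_trans (rnorm_sum _ _ _) _.
rewrite -[X in X%:R]card_ord mulr_natl -sumr_const.
by apply: ler_sum.
Qed.

Hypothesis symV : symmetric_op V.

Lemma iter_sym j : symmetric_op (iter j V).
Proof. by elim: j => //= j IHj x y; rewrite symV IHj -iterSr. Qed.

Lemma avg_sym m : symmetric_op (avg m).
Proof.
move=> x y; rewrite /avg cmulZl starZ conjc_real cmulZr; congr (_ *: _).
rewrite (big_morph (cmul^~ (star y)) (fun a b => cmulDl a b _) (cmul0l _)).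
rewrite (big_morph star starD star0).
rewrite (big_morph (cmul x) (fun a b => cmulDr a b x) (cmul0r _)).
by apply: eq_bigr => j _; rewrite iter_sym.
Qed.

Hypothesis V1 : forall x, rnorm (V x) <= rnorm x.

Lemma rnorm_iter j x : rnorm (iter j V x) <= rnorm x.
Proof. by elim: j => //= j; apply: le_trans. Qed.

Lemma rnorm_avg m x : rnorm (avg m x) <= rnorm x.
Proof.
by apply: (@rnorm_mean (fun j => iter j V x)) => j; apply: rnorm_iter.
Qed.

(** The averages of x tend to 0 at the rate 1 / m, a form of convergence that
    sums preserve. *)
Definition avg_decays x : Prop :=
  exists c : R, forall m, m.+1%:R * rnorm (avg m x) <= c.

Lemma avg_decaysD x y : avg_decays x -> avg_decays y -> avg_decays (x + y).
Proof.
move=> [c xc] [c' yc']; exists (c + c') => m; rewrite linearD.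
apply: le_trans (lerD (xc m) (yc' m)).
by rewrite -mulrDr ler_wpM2l ?ler0n// rnormD.
Qed.

(** The sum of V ^+ j (x - V x) telescopes. *)
Lemma avg_decays_sub x : avg_decays (x - V x).
Proof.
exists (rnorm x + rnorm x) => m.
have -> : avg m (x - V x) = (m.+1%:R^-1)%:C *: (x - iter m.+1 V x).
  congr (_ *: _); elim: m.+1 => [|i IHi]; first by rewrite big_ord0 subrr.
  by rewrite big_ord_recr/= IHi linearB/= -iterSr addrA subrK.
rewrite rnormZ ?invr_ge0// mulrA divff ?pnatr_eq0// mul1r.
by apply: le_trans (rnormB _ _) _; rewrite lerD2l rnorm_iter.
Qed.

Lemma avg_decays_sub_iter j x : avg_decays (x - iter j V x).
Proof.
elim: j x => [|j IHj] x.
  by exists 0 => m; rewrite subrr linear0 rnorm0 mulr0.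
rewrite -(subrK (V x) x) -addrA iterSr subrK.
by apply: avg_decaysD; [exact: avg_decays_sub|exact: IHj].
Qed.

(** So 1 - avg k, for growing k, is an approximate unit on the ranges of the
    operators 1 - avg l. *)
Lemma avg_decays_sub_avg k x : avg_decays (x - avg k x).
Proof.
rewrite sub_avgE.
have [c sc] : avg_decays (\sum_(j < k.+1) (x - iter j V x)).
  apply: big_ind => [||j _]; last exact: avg_decays_sub_iter.
  - by exists 0 => m; rewrite linear0 rnorm0 mulr0.
  - exact: avg_decaysD.
exists (k.+1%:R^-1 * c) => m.
by rewrite linearZ_LR rnormZ ?invr_ge0// mulrCA ler_wpM2l ?invr_ge0.
Qed.

Lemma avg_decays_near x (e : R) : avg_decays x -> 0 < e ->
  \forall m \near \oo, rnorm (avg m x) <= e.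
Proof.
move=> [c xc] e0; near=> m.
rewrite -(@ler_pM2l _ m.+1%:R) ?ltr0n//; apply: le_trans (xc m) _.
rewrite -ler_pdivrMr// -natr1 ler_wpDr//.
by near: m; exact: nbhs_infty_ger.
Unshelve. all: by end_near. Qed.

End ErgodicAverages.

(** * Contractive projections and approximate units *)

Section InvariantDefect.
Variables (B : set A) (E : {linear A -> A}) (V : {linear A -> A}) (n : A).
Hypothesis B0 : B 0.
Hypothesis BP : forall (k : R[i]) x y, B x -> B y -> B (k *: x + y).
Hypothesis E_contr : forall x, rnorm (E x) <= rnorm x.
Hypothesis E_onto : forall x, B (E x).
Hypothesis E_id : forall x, B x -> E x = x.
Hypothesis symV : symmetric_op V.
Hypothesis V1 : forall x, rnorm (V x) <= rnorm x.
Hypothesis subV1 : forall j x, rnorm (x - iter j V x) <= rnorm x.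
Hypothesis B_subV : forall x, B x -> B (x - V x).
Hypothesis n_subV : B (n - V n).

(** The defect of n: what has to be shown is that V leaves it invariant. *)
Let v := E n - n.

Lemma sub_avg_closed k x : B (x - V x) -> B (x - avg V k x).
Proof.
move=> Bx; rewrite sub_avgE; apply: lin_closedZ => //.
apply: big_ind => [//||j _]; first exact: lin_closedD.
elim: (j : nat) => [|i IHi]; first by rewrite subrr.
have -> : x - iter i.+1 V x = (x - V x) + V (x - iter i V x).
  by rewrite linearB addrA subrK.
apply: lin_closedD => //; rewrite -[V _](subKr (x - iter i V x)).
by apply: lin_closedB => //; apply: B_subV.
Qed.

(** An approximate Pythagorean inequality: avg m is symmetric, so the cross term
    <avg m n, x> equals <n, avg m x>. *)
Lemma rnorm_avg_addZ m (t : R) x : 0 <= t ->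
  rnorm (avg V m n + t%:C *: x) ^+ 2 <=
  rnorm n ^+ 2 + (t * rnorm x) ^+ 2 + 2 * t * rnorm n * rnorm (avg V m x).
Proof.
move=> t0; set y := avg V m n; set h := _ *: x.
have yh : rnorm (y ** star h) <= t * rnorm n * rnorm (avg V m x).
  rewrite /h starZ conjc_real cmulZr rnormZ// -mulrA ler_wpM2l//.
  by rewrite avg_sym// (le_trans (rnormM _ _))// rnorm_star.
have hy : rnorm (h ** star y) = rnorm (y ** star h).
  by rewrite -[LHS]rnorm_star starM starK.
rewrite -rnormM_star starD cmulDl !cmulDr.
have yy : rnorm (y ** star y) <= rnorm n ^+ 2.
  rewrite rnormM_star ler_pXn2r// ?nnegrE ?rnorm_ge0//; exact: rnorm_avg.
have hh : rnorm (h ** star h) = (t * rnorm x) ^+ 2.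
  by rewrite rnormM_star rnormZ.
have := rnormD (y ** star y + y ** star h) (h ** star y + h ** star h).
have := rnormD (y ** star y) (y ** star h).
have := rnormD (h ** star y) (h ** star h).
lra.
Qed.

(** Write f k := 1 - avg k.  As f m n and f l v lie in B, E maps
    avg m n + t (f l v) to v + avg m n + t (f l v).  The contraction f k of this
    element tends to (1 + t) (f k v) as m and then l grow, while by the
    approximate Pythagorean inequality the norm before applying E tends to at most
    sqrt (norm n ^+ 2 + (t * L) ^+ 2). *)
Lemma defect_bound_improves (t L : R) k :
  0 <= t -> (forall l, rnorm (v - avg V l v) <= L) ->
  (1 + t) * rnorm (v - avg V k v) <= Num.sqrt (rnorm n ^+ 2 + (t * L) ^+ 2).
Proof.
move=> t0 vL; apply/ler_addgt0Pr => e e0.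
have f_decays l x : avg_decays V (x - avg V l x) by exact: avg_decays_sub_avg.
have e3 : 0 < e / 3 by rewrite divr_gt0.
have [l hl] : exists l, rnorm (avg V l (v - avg V k v)) <= e / 3 / (t + 1).
  apply: (@filter_ex _ \oo); apply: (avg_decays_near (f_decays _ _)).
  by rewrite divr_gt0// ltr_wpDl.
pose w := v - avg V l v.
have [m [hm hm']] : exists m, rnorm (avg V m (n - avg V k n)) <= e / 3 /\
    rnorm (avg V m w) <= (e / 3) ^+ 2 / (2 * t * rnorm n + 1).
  apply: (@filter_ex _ \oo); near=> m; split; near: m.
    exact: (avg_decays_near (f_decays _ _)).
  apply: (avg_decays_near (f_decays _ _)).
  rewrite divr_gt0 ?exprn_gt0// ltr_wpDl//.
  by rewrite !mulr_ge0// rnorm_ge0.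
have Bw : B w.
  apply: sub_avg_closed; rewrite /v linearB/=.
  have -> : E n - n - (V (E n) - V n) = (E n - V (E n)) - (n - V n).
    by rewrite !opprD !opprK addrACA.
  by apply: lin_closedB => //; apply: B_subV.
set y := avg V m n; set h := t%:C *: w.
have Eyh : E (y + h) = v + y + h.
  rewrite linearD (E_id (lin_closedZ B0 BP _ Bw)); congr (_ + _).
  rewrite -[y](subKr n) linearB (E_id (sub_avg_closed _ n_subV)) /v.
  by rewrite addrA subrK.
have X1 : rnorm (v + y + h) <= Num.sqrt (rnorm n ^+ 2 + (t * L) ^+ 2) + e / 3.
  rewrite -Eyh; apply: le_trans (E_contr _) _.
  have c0 : 0 <= rnorm n ^+ 2 + (t * L) ^+ 2 by rewrite addr_ge0 ?sqr_ge0.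
  have s0 := sqrtr_ge0 (rnorm n ^+ 2 + (t * L) ^+ 2).
  have ss := sqr_sqrtr c0.
  rewrite -(@ler_pXn2r _ 2)// ?nnegrE ?addr_ge0 ?rnorm_ge0 ?(ltW e3)//.
  apply: le_trans (rnorm_avg_addZ m w t0) _.
  have tN0 : 0 <= 2 * t * rnorm n by rewrite !mulr_ge0// rnorm_ge0.
  have cross : 2 * t * rnorm n * rnorm (avg V m w) <= (e / 3) ^+ 2.
    move: hm'; rewrite ler_pdivlMr ?ltr_wpDl// => hm'.
    have := rnorm_ge0 (avg V m w); lra.
  have tw : (t * rnorm w) ^+ 2 <= (t * L) ^+ 2.
    have L0 : 0 <= L by exact: le_trans (rnorm_ge0 _) (vL 0%N).
    by rewrite ler_pXn2r ?nnegrE ?mulr_ge0 ?rnorm_ge0// ler_wpM2l// vL.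
  rewrite sqrrD; nra.
have X2 : rnorm ((1 + t)%:C *: (v - avg V k v)) <= rnorm (v + y + h) +
    rnorm (avg V m (n - avg V k n)) + t * rnorm (avg V l (v - avg V k v)).
  pose F : {linear A -> A} := (idfun \- avg V k)%R.
  have FV z : F (V z) = V (F z).
    by rewrite /= linearB/= (avg_comp _ _ (fun=> erefl)).
  have Favg i z : F (avg V i z) = avg V i (F z) by exact: avg_comp.
  have F1 z : rnorm (F z) <= rnorm z.
    by rewrite /F/= sub_avgE; apply: (@rnorm_mean (fun j => z - iter j V z)).
  have -> : (1 + t)%:C *: (v - avg V k v) =
      F (v + y + h) - avg V m (F n) + t%:C *: avg V l (F v).
    have Fw : F w = F v - avg V l (F v) by rewrite linearB Favg.
    have -> : F (v + y + h) = F v + avg V m (F n) + t%:C *: F w.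
      by rewrite -(Favg m n) -linearZ_LR -!linearD.
    have -> : (1 + t)%:C *: (v - avg V k v) = F v + t%:C *: F v.
      by rewrite rmorphD/= scalerDl scale1r.
    rewrite Fw; move: (avg V l (F v)) (avg V m (F n)) (F v) => b c a.
    by rewrite scalerBr [a + c + _]addrAC addrK -addrA subrK.
  apply: le_trans (rnormD _ _) _; rewrite rnormZ// lerD2r.
  by apply: le_trans (rnormB _ _) _; rewrite lerD2r F1.
move: X2; rewrite rnormZ ?addr_ge0//.
have : t * rnorm (avg V l (v - avg V k v)) <= e / 3.
  move: hl; rewrite ler_pdivlMr ?ltr_wpDl// => hl.
  have := rnorm_ge0 (avg V l (v - avg V k v)); lra.
lra.
Unshelve. all: by end_near. Qed.

(** The bounds of the sequence norm (f k v) improve themselves, so it vanishes;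
    and f 1 v is half of v - V v. *)
Lemma expectation_defect_invariant : V (E n - n) = E n - n.
Proof.
have a0 : forall k, rnorm (v - avg V k v) = 0.
  apply: (@bounded_self_improving _ _ (rnorm n ^+ 2) (rnorm v)).
  - exact: sqr_ge0.
  - move=> k; rewrite rnorm_ge0 sub_avgE.
    by apply: (@rnorm_mean (fun j => v - iter j V v)).
  - by move=> t L t0 vL k; apply: defect_bound_improves.
have := rnorm0_eq0 (a0 1%N).
rewrite sub_avgE big_ord_recr big_ord1/= subrr add0r => /(congr1 rnorm).
rewrite rnormZ ?invr_ge0// rnorm0 => /eqP.
rewrite mulf_eq0 invr_eq0 pnatr_eq0/=.
by move=> /eqP/rnorm0_eq0/eqP; rewrite subr_eq0 => /eqP <-.
Qed.
End InvariantDefect.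

Lemma iter_comp_self (W : A -> A) j x :
  iter j (W \o W) x = iter j W (iter j W x).
Proof. by elim: j => //= j ->; rewrite -[in RHS]iterSr. Qed.

(** * Expectations and multiplication *)

Definition rmul d x : A := x ** d.

Lemma rmul_is_linear d : linear (rmul d).
Proof. by move=> k x y; rewrite /rmul cmulPl. Qed.

HB.instance Definition _ d :=
  GRing.isLinear.Build R[i] A A _ (rmul d) (rmul_is_linear d).

Lemma rmul_sym d : star d = d -> symmetric_op (rmul d).
Proof. by move=> dd x y; rewrite /rmul starM dd cmulA. Qed.

(** [(x ** d) ** star (x ** d)] is [x ** d ** d ** star x]. *)
Lemma cmul_self_adjoint_eq0 x d : star d = d -> x ** d ** d = 0 -> x ** d = 0.
Proof.
by move=> dd xdd; apply: cmul_star_eq0; rewrite starM dd cmulA xdd cmul0l.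
Qed.

(** With d a small multiple of [b ** star b], T right multiplication by d and
    V := (1 - T ^+ 2) ^+ 2, every 1 - V ^+ j = 1 - ((1 - T ^+ 2) ^+ j) ^+ 2 is
    a contraction and n - V n lies in B, so the defect v := E n - n is invariant
    under V.  As 1 - V = T ^+ 2 (2 - T ^+ 2), p := T ^+ 2 v satisfies
    2 p = T ^+ 2 p, which forces p = 0; v b = 0 follows by cancelling adjoints. *)
Lemma expectation_cmul (B : set A) (E : {linear A -> A}) n b :
    cstar_subalgebra B -> (forall x, `|E x| <= `|x|) ->
    (forall x, B (E x)) -> (forall x, B x -> E x = x) ->
  B b -> B (n ** b) -> E n ** b = n ** b.
Proof.
move=> [B0 BP [BM Bstar] _] E_contr E_onto E_id Bb Bnb.
have BZ := lin_closedZ B0 BP; have BD := lin_closedD BP.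
have BB := lin_closedB B0 BP.
(* the factor r makes d a contraction *)
pose c := b ** star b; pose r := (rnorm c + 1)^-1.
have r0 : 0 < r by rewrite invr_gt0 ltr_wpDl ?rnorm_ge0.
pose d := r%:C *: c.
have dd : star d = d by rewrite /d starZ conjc_real /c starM starK.
have d1 : rnorm d <= 1.
  rewrite /d rnormZ ?(ltW r0)// mulrC /r ler_pdivrMr ?ltr_wpDl ?rnorm_ge0//.
  by rewrite mul1r lerDl.
have Bd : B d by apply/BZ/BM => //; apply: Bstar.
have Bnd : B (n ** d) by rewrite cmulZr cmulA; apply/BZ/BM => //; apply: Bstar.
pose T : {linear A -> A} := rmul d.
pose W : {linear A -> A} := (idfun \- (T \o T))%R.
pose V : {linear A -> A} := (W \o W)%FUN.
have symT : symmetric_op T by exact: rmul_sym.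
have symW : symmetric_op W.
  by move=> x y; rewrite /W/= cmulBl starB cmulBr !symT.
have symV : symmetric_op V by move=> x y; rewrite /V/= !symW.
have T1 x : rnorm (T x) <= rnorm x.
  apply: le_trans (rnormM _ _) _; by rewrite ler_piMr ?rnorm_ge0.
have W1 x : rnorm (W x) <= rnorm x by exact: rnorm_sub_sqr.
have V1 x : rnorm (V x) <= rnorm x by exact: le_trans (W1 _) (W1 _).
have subV1 j x : rnorm (x - iter j V x) <= rnorm x.
  rewrite [iter j V x](iter_comp_self W); apply: rnorm_sub_sqr.
    exact: iter_sym.
  by move=> y; apply: rnorm_iter.
have BT x : B x -> B (T x) by move=> Bx; apply: BM.
have BW x : B x -> B (W x) by move=> Bx; apply: BB => //; apply/BT/BT.
have BV x : B x -> B (x - V x) by move=> Bx; apply: BB => //; apply/BW/BW.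
have BnV : B (n - V n).
  have -> : n - V n = T (T n) + W (T (T n)).
    have -> : V n = n - T (T n) - W (T (T n)) := linearB W n (T (T n)).
    by rewrite -addrA -opprD subKr.
  have BTT : B (T (T n)) by apply/BT.
  by apply: BD => //; apply: BW.
have E_rcontr x : rnorm (E x) <= rnorm x by rewrite rnorm_le.
have := expectation_defect_invariant B0 BP E_rcontr E_onto E_id
  symV V1 subV1 BV BnV.
set v := E n - n => Vv.
have TTv : T (T v) = 0.
  set p := T (T v).
  have p2 : p + p = T (T p).
    have : v - (p + (p - T (T p))) = v.
      have Vv' : V v = v - p - (p - T (T p)) := linearB W v p.
      by rewrite opprD addrA -Vv'.
    move=> /(congr1 (fun z => v - z)).
    by rewrite subKr subrr addrA => /subr0_eq.
  apply: rnorm0_eq0; apply/le_anti; rewrite rnorm_ge0 andbT.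
  have : rnorm (p + p) <= rnorm p by rewrite p2; apply: le_trans (T1 _) (T1 _).
  rewrite -mulr2n -scaler_nat -(rmorph_nat (real_complex R)) rnormZ ?ler0n//.
  have := rnorm_ge0 p; lra.
have vd : v ** d = 0 by exact: cmul_self_adjoint_eq0.
have vc : v ** c = 0.
  move/eqP: vd; rewrite cmulZr scaler_eq0 => /orP[|/eqP//].
  by rewrite -[0]/(0%:C) (inj_eq (@complexI _)) gt_eqF.
apply/eqP; rewrite -subr_eq0 -cmulBl; apply/eqP/cmul_star_eq0.
by rewrite starM cmulA -(cmulA _ b) vc cmul0l.
Qed.

Lemma cartan_base_subalgebra (N : set A) : cstar_subalgebra (cartan_base N).
Proof.
rewrite /cartan_base /cstar_generated /smallest; split.
- by move=> S [[]].
- move=> k x y Bx By S SN; have [[_ SP _ _] _] := SN.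
  by apply: SP; [exact: Bx|exact: By].
- split=> [x y Bx By|x Bx] S SN; have [[_ _ [SM Sstar] _] _] := SN.
    by apply: SM; [exact: Bx|exact: By].
  by apply: Sstar; exact: Bx.
- by apply: closed_bigI => S [[]].
Qed.

(** Put e := E n and f := F n.  The element [n ** star f], adjoint of
    [f ** star n], lies in B, so [e ** star f = n ** star f = f ** star f];
    exchanging roles, [f ** star e = e ** star e].  Hence
    [(e - f) ** star (e - f) = 0]. *)
Lemma cartan_expectation_eq_on (N : set A) (E F : A -> A) n :
  cartan_expectation N E -> cartan_expectation N F -> N n -> E n = F n.
Proof.
have key (E' F' : A -> A) :
    cartan_expectation N E' -> cartan_expectation N F' -> N n ->
    E' n ** star (F' n) = n ** star (F' n).
  move=> [[[E_lin E_contr E_idem] E_range] _] [[_ F_range] F_n] Nn.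
  have Bsub := cartan_base_subalgebra N; have [_ _ [_ Bstar] _] := Bsub.
  pose E1 : {linear A -> A} :=
    HB.pack E' (GRing.isLinear.Build R[i] A A _ E' E_lin).
  have BE x : cartan_base N (E1 x) by rewrite -E_range; exists x.
  have E1_id x : cartan_base N x -> E1 x = x.
    by rewrite -E_range => -[y _ <-]; exact: E_idem.
  have BF : cartan_base N (star (F' n)).
    by apply: Bstar; rewrite -F_range; exists n.
  have BnF : cartan_base N (n ** star (F' n)).
    by have := Bstar _ (F_n n Nn); rewrite starM starK.
  exact: (@expectation_cmul _ E1 n _ Bsub E_contr BE E1_id BF BnF).
move=> hE hF Nn; apply/eqP; rewrite -subr_eq0; apply/eqP/cmul_star_eq0.
have EF := key _ _ hE hF Nn; have FE := key _ _ hF hE Nn.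
rewrite starB cmulBl !cmulBr EF FE -(key _ _ hE hE Nn) -(key _ _ hF hF Nn).
exact: subrr.
Qed.

Lemma dense_eq_contraction (S : set A) (E F : A -> A) : linear E -> linear F ->
    (forall x, `|E x| <= `|x|) -> (forall x, `|F x| <= `|x|) ->
    dense (linear_span S : set A) -> (forall x, S x -> E x = F x) ->
  E = F.
Proof.
move=> E_lin F_lin E1 F1 denseS EF; apply/funext => x.
pose E' : {linear A -> A} :=
  HB.pack E (GRing.isLinear.Build R[i] A A _ E E_lin).
pose F' : {linear A -> A} :=
  HB.pack F (GRing.isLinear.Build R[i] A A _ F F_lin).
apply/eqP; rewrite -subr_eq0 -normr_le0; apply/ler_addgt0Pr => e e0.
rewrite add0r.
have e2 : 0 < e / 2 by rewrite divr_gt0.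
have [|y [xy [m [a [v [Sv yE]]]]]] := denseS (ball x (e / 2)) _ (ball_open _ _).
  by exists x; exact: ballxx.
have EFy : E' y = F' y.
  rewrite yE !linear_sum; apply: eq_bigr => i _.
  by rewrite !linearZ_LR/= EF.
have -> : E x - F x = E' (x - y) - F' (x - y).
  by rewrite (linearB E') (linearB F') EFy opprB addrA subrK.
apply: le_trans (ler_normB _ _) _; rewrite [e]splitr.
move: xy; rewrite -ball_normE /= => /ltW xy.
by apply: lerD; [exact: le_trans (E1 _) xy|exact: le_trans (F1 _) xy].
Qed.

End CStarAlgebraTheory.

Theorem corollary6p3 (R : realType) (A : cstarAlgType R) (N : set A)
  (hN : cartan_semigroup N) :
  exists! E : A -> A, cartan_expectation N E.
Proof.
case: hN => -[_ _ denseN] _ [E hE]; exists E; split => // F hF.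
have [[[E_lin E1 _] _] _] := hE; have [[[F_lin F1 _] _] _] := hF.
apply: (dense_eq_contraction E_lin F_lin E1 F1 denseN) => n.
exact: cartan_expectation_eq_on.
Qed.
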